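(* Let $G$ be a connected finite simple graph with $n$ vertices and $m$ edges, and let $$p_m(t)=-1+\sum_{i=0}^m a_i t^i$$ be the polynomial integrand in Steele's formula for the expected length of the minimal spanning tree of $G$. Then $$a_0=n,\qquad a_1=-m,\qquad a_2=0.$$
   Context: For a finite simple graph $H$, the rank is $r(H)=|V(H)|-k(H)$, where $k(H)$ is the number of connected components of $H$. For a finite simple graph $G$, $S(G)$ denotes the set of spanning subgraphs of $G$ (subgraphs with vertex set $V(G)$ and edge set any subset of $E(G)$). The Tutte polynomial of $G$ is $$T(G;x,y)=\sum_{A\in S(G)}(x-1)^{r(G)-r(A)}(y-1)^{|E(A)|-r(A)},$$ and $T_x$ denotes its partial derivative with respect to $x$. Steele's formula says that, for a connected graph $G$ whose edges have independent lengths uniform on $[0,1]$, the expected total length of a minimal spanning tree is $\int_0^1\frac{1-t}{t}\,\frac{T_x(G;\frac1t,\frac1{1-t})}{T(G;\frac1t,\frac1{1-t})}\,dt$. The polynomial integrand $p_m(t)$, where $m=|E(G)|$, is the polynomial (of degree at most $m$) that agrees with $\frac{1-t}{t}\,\frac{T_x(G;\frac1t,\frac1{1-t})}{T(G;\frac1t,\frac1{1-t})}$ for $t\in(0,1)$. The numbers $a_i$ are defined by $p_m(t)=-1+\sum_{i=0}^m a_it^i$, i.e. $a_i$ is the coefficient of $t^i$ in $p_m(t)+1$; by convention $a_i=0$ for $i>m$. *)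

(* Defs.v *)
From mathcomp Require Import all_boot all_order all_algebra.
From mathcomp Require Import reals.

Set Implicit Arguments.
Unset Strict Implicit.
Unset Printing Implicit Defensive.

Import Order.TTheory GRing.Theory Num.Theory.
Local Open Scope ring_scope.

(* A finite simple graph with vertex set V is given by its edge set E, a set
   of 2-element subsets of V; the spanning subgraphs of E are the A \subset E. *)
Definition simple_graph (V : finType) (E : {set {set V}}) : Prop :=
  forall e : {set V}, e \in E -> #|e| = 2%N.

Definition adj (V : finType) (E : {set {set V}}) : rel V :=
  [rel u v | [set u; v] \in E].

(* The graph without vertices has no connected component, so it is not
   connected. *)
Definition connected_graph (V : finType) (E : {set {set V}}) : Prop :=
  (0 < #|V|)%N /\ forall u v : V, connect (adj E) u v.

Definition ncomponents (V : finType) (E : {set {set V}}) : nat :=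
  n_comp (adj E) V.

Definition rank (V : finType) (E : {set {set V}}) : nat :=
  (#|V| - ncomponents E)%N.

(* In {poly {poly R}} the outer variable 'X is x and the inner one,
   'Y = 'X%:P, is y, as in the evaluation p.[x, y] of polyXY; the derivative
   p^`() is thus the partial derivative in x. The subtractions on exponents
   do not truncate: rank A <= rank E for A \subset E, and rank A <= #|A|. *)
Definition tutte (R : comNzRingType) (V : finType) (E : {set {set V}}) :
    {poly {poly R}} :=
  \sum_(A : {set {set V}} | A \subset E)
    ('X - 1) ^+ (rank E - rank A) * ('Y - 1) ^+ (#|A| - rank A).

Definition steele_integrand (R : realType) (V : finType)
    (E : {set {set V}}) (t : R) : R :=
  (1 - t) / t * ((tutte R E)^`().[t^-1, (1 - t)^-1]
                 / (tutte R E).[t^-1, (1 - t)^-1]).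

Definition polynomial_integrand (R : realType) (V : finType)
    (E : {set {set V}}) (p : {poly R}) : Prop :=
  (size p <= #|E|.+1)%N /\
  forall t : R, 0 < t < 1 -> p.[t] = steele_integrand E t.

(* p = -1 + \sum_i a_i 'X^i with a_i = integrand_coef p i. *)
Definition integrand_coef (R : realType) (p : {poly R}) (i : nat) : R :=
  (p + 1)`_i.

(* Main.v *)
Require Import Defs.
From mathcomp Require Import all_boot all_order all_algebra.
From mathcomp Require Import reals.
From mathcomp Require Import ring.

Set Implicit Arguments.
Unset Strict Implicit.
Unset Printing Implicit Defensive.

Import Order.TTheory GRing.Theory Num.Theory.
Local Open Scope ring_scope.

(* At x = 1/t, y = 1/(1-t) one has (x-1)(y-1) = 1, so the summand of T indexed
   by A is q^(r(E)-|A|) with q = (1-t)/t. Hence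
   p + 1 = \sum_A k(A) t^|A| (1-t)^(m-|A|),
   the expected number of components of the random subgraph that keeps each
   edge with probability t. As G is simple, k(A) = n - |A| when |A| <= 2, so
   modulo t^3 this is n minus the mean of a binomial variable: n - m t. *)

(** * Component counts when one edge is added, and for few edges *)

Section Components.

Variable V : finType.
Implicit Types (A E : {set {set V}}) (u v x y : V).

Local Notation root := fingraph.root.

Lemma adj_connect_sym A : connect_sym (adj A).
Proof. by apply: sym_connect_sym => x y; rewrite /adj /= setUC. Qed.

Lemma adj_setU1 A u v x y :
  adj ([set u; v] |: A) x y =
  [|| (x == u) && (y == v), (x == v) && (y == u) | adj A x y].
Proof.
rewrite /adj /= in_setU1 orbA; congr (_ || _).
apply/eqP/idP => [xy|/orP[]/andP[/eqP-> /eqP->]//]; last exact: setUC.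
(* Each endpoint of either pair lies in the other pair; these four memberships leave only the two
   orderings, even if [u = v]. *)
have := set21 x y; have := set22 x y; rewrite xy !inE.
have := set21 u v; have := set22 u v; rewrite -xy !inE !(eq_sym u) !(eq_sym v).
by case: (x == u) (x == v) (y == u) (y == v) => [] [] [] [].
Qed.

Lemma sub_adj_setU1 A e x y : connect (adj A) x y -> connect (adj (e |: A)) x y.
Proof.
apply: connect_sub => a b ab; apply: connect1.
by rewrite /adj /= in_setU1 [X in _ || X]ab orbT.
Qed.

(** Along a path every step either stays in an old component or crosses the new edge, and repeated
    crossings only toggle between the old components of [u] and [v]. Comparing roots turns this into
    a boolean formula. *)
Lemma connect_setU1 A u v x y (r := root (adj A)) : u != v ->
  connect (adj ([set u; v] |: A)) x y =
  [|| r x == r y, (r x == r u) && (r y == r v) | (r x == r v) && (r y == r u)].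
Proof.
move=> uv; have sA := adj_connect_sym A.
have uvC : connect (adj ([set u; v] |: A)) u v.
  by apply: connect1; rewrite adj_setU1 !eqxx.
apply/idP/idP; last first.
  have rC a b : r a == r b -> connect (adj ([set u; v] |: A)) a b.
    by rewrite /r root_connect // => /sub_adj_setU1.
  case/or3P => [/rC //|/andP[/rC xu /rC yv]|/andP[/rC xv /rC yu]].
    apply: connect_trans xu (connect_trans uvC _).
    by rewrite adj_connect_sym.
  apply: connect_trans xv _; rewrite adj_connect_sym.
  exact: connect_trans yu uvC.
case/connectP => p; elim: p x => [|z p IHp] x /=.
  by move=> _ ->; rewrite eqxx.
case/andP; rewrite adj_setU1 => xz pz /(IHp _ pz) {IHp pz}.
case/or3P: xz => [/andP[/eqP-> /eqP->]|/andP[/eqP-> /eqP->]|xz].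
- by case/or3P=> [|/andP[_]|/andP[_]]; rewrite ?eqxx eq_sym => ->; rewrite ?orbT.
- by case/or3P=> [|/andP[_]|/andP[_]]; rewrite ?eqxx eq_sym => ->; rewrite ?orbT.
have -> // : r x = r z.
by apply/eqP; rewrite /r root_connect // connect1.
Qed.

Lemma ncomponentsE A : ncomponents A = #|roots (adj A)|.
Proof. by apply: eq_card => x; rewrite !inE andbT. Qed.

(* When u and v are not connected in A, taking the new root is a bijection from
   the old roots other than that of v to the new roots. *)
Lemma ncomponents_setU1 A u v : u != v ->
  (ncomponents ([set u; v] |: A) + ~~ connect (adj A) u v)%N = ncomponents A.
Proof.
move=> uv; set B := _ |: A; have sA := adj_connect_sym A.
have sB := adj_connect_sym B.
have rootA x : root (adj A) (root (adj A) x) = root (adj A) x.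
  exact: root_root.
have cB := connect_setU1 A _ _ uv; rewrite -/B in cB.
case: (boolP (connect _ _ _)) => cuv /=.
  rewrite addn0; apply: eq_n_comp => x y; rewrite cB -(root_connect sA).
  move: cuv; rewrite -(root_connect sA) => /eqP->.
  apply/or3P/idP => [[//|/andP[/eqP-> /eqP->]//|/andP[/eqP-> /eqP->]//]|->].
  by constructor.
have nuv : root (adj A) u != root (adj A) v by rewrite root_connect.
set S := [set x in roots (adj A)] :\ root (adj A) v.
have -> : ncomponents A = (#|S|).+1.
  rewrite ncomponentsE -cardsE (cardsD1 (root (adj A) v)) inE.
  by rewrite /in_mem /= roots_root.
rewrite addn1 ncomponentsE; congr _.+1.
have inS x : (x \in S) = (root (adj A) x == x) && (x != root (adj A) v).
  by rewrite !inE andbC.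
rewrite -(@card_in_imset _ _ (root (adj B)) S).
  rewrite -[RHS]cardsE; apply: eq_card => x; rewrite inE.
  apply/idP/imsetP => [rx|[y _ ->]]; last exact: roots_root.
  have eqx y : connect (adj B) x y -> x = root (adj B) y.
    by rewrite -(root_connect sB) => /eqP<-; rewrite (eqP rx).
  (* The discarded root of [v] is replaced by that of [u], which lies in the same merged
     component. *)
  have [xv|xv] := eqVneq (root (adj A) x) (root (adj A) v).
    exists (root (adj A) u); first by rewrite inS rootA eqxx.
    by apply: eqx; rewrite cB rootA xv !eqxx !orbT.
  exists (root (adj A) x); first by rewrite inS rootA eqxx.
  by apply: eqx; rewrite cB rootA eqxx.
(* Injectivity: neither [x] nor [y] is the old root of [v], so both merging alternatives of [cB]
   fail. *)
move=> x y; rewrite !inS => /andP[/eqP xr xv] /andP[/eqP yr yv] /eqP.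
rewrite root_connect // cB xr yr (negPf xv) (negPf yv) andbF /= orbF.
exact: eqP.
Qed.

Lemma root_adj0 x : root (adj set0) x = x.
Proof.
have /connectP[[|z p] /=] := connect_root (adj set0) x; first by [].
by rewrite /adj /= inE.
Qed.

Lemma ncomponents0 : ncomponents (set0 : {set {set V}}) = #|V|.
Proof. by rewrite ncomponentsE; apply: eq_card => x; apply/eqP/root_adj0. Qed.

Lemma ncomponents_le_card A : (ncomponents A <= #|V|)%N.
Proof. by rewrite ncomponentsE max_card. Qed.

Lemma ncomponents_gt0 A : (0 < #|V|)%N -> (0 < ncomponents A)%N.
Proof.
case/card_gt0P=> x _; rewrite ncomponentsE; apply/card_gt0P.
by exists (root (adj A) x); apply/roots_root/adj_connect_sym.
Qed.

Lemma ncomponents_connected E : connected_graph E -> ncomponents E = 1%N.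
Proof.
case=> V0 cE; apply/eqP; rewrite eqn_leq ncomponents_gt0 // andbT.
rewrite ncomponentsE; apply/card_le1_eqP => x y /eqP <- /eqP <-.
by apply/eqP; rewrite root_connect //; apply: adj_connect_sym.
Qed.

Lemma simple_graphD1 A e : simple_graph A -> simple_graph (A :\ e).
Proof. by move=> sA f /setD1P[_ /sA]. Qed.

Lemma simple_graph_edge A e : simple_graph A -> e \in A ->
  exists u v, u != v /\ e = [set u; v].
Proof. by move=> sA /sA /eqP/cards2P[u [v [uv ->]]]; exists u, v. Qed.

(** Starting from [#|V|] isolated vertices, each edge lowers the number of components by at most
    one. This is what yields [rank A <= #|A|]. *)
Lemma card_le_ncomponents A : simple_graph A ->
  (#|V| <= ncomponents A + #|A|)%N.
Proof.
elim: {A}_.+1 {-2}A (ltnSn #|A|) => // k IHk A ltk sA.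
have [->|[e eA]] := set_0Vmem A; first by rewrite ncomponents0 leq_addr.
have [u [v [uv e_uv]]] := simple_graph_edge sA eA.
have cA := cardsD1 e A; rewrite eA in cA.
have := ncomponents_setU1 (A :\ e) uv; rewrite -e_uv setD1K // => nA.
apply: leq_trans (IHk _ _ (@simple_graphD1 _ e sA)) _.
  by rewrite -ltnS (leq_trans _ ltk) // cA.
by rewrite -nA cA addnA leq_add2r leq_add2l leq_b1.
Qed.

Lemma connect_adj_card_le1 A u v : simple_graph A -> (#|A| <= 1)%N -> u != v ->
  connect (adj A) u v -> [set u; v] \in A.
Proof.
move=> sA A1 uv; have [A0|[e eA]] := set_0Vmem A.
  rewrite -root_connect; last exact: adj_connect_sym.
  by rewrite A0 !root_adj0 (negPf uv).
have [a [b [ab e_ab]]] := simple_graph_edge sA eA.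
have -> : A = [set a; b] |: set0.
  by apply/eqP; rewrite setU0 -e_ab eq_sym eqEcard sub1set eA cards1.
rewrite connect_setU1 // !root_adj0 (negPf uv) /= in_setU1.
by case/orP => /andP[/eqP-> /eqP->]; rewrite 1?(setUC [set b]) eqxx.
Qed.

(** A cycle in a simple graph has at least three edges, so here every edge joins two distinct
    components of the rest and lowers the count by exactly one. *)
Lemma ncomponents_small A : simple_graph A -> (#|A| <= 2)%N ->
  (ncomponents A + #|A|)%N = #|V|.
Proof.
elim: {A}_.+1 {-2}A (ltnSn #|A|) => // k IHk A ltk sA A2.
have [->|[e eA]] := set_0Vmem A; first by rewrite ncomponents0 cards0 addn0.
have [u [v [uv e_uv]]] := simple_graph_edge sA eA.
have cA := cardsD1 e A; rewrite eA add1n in cA.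
have sAe := @simple_graphD1 _ e sA.
have A1 : (#|A :\ e| <= 1)%N by rewrite -ltnS -cA.
have := ncomponents_setU1 (A :\ e) uv; rewrite -e_uv setD1K //.
(* If [e] closed a cycle, the at most one other edge would have the same endpoints, hence be [e]
   itself. *)
case: (boolP (connect _ _ _)) => [/(connect_adj_card_le1 sAe A1 uv)|_ nA].
  by rewrite -e_uv setD11.
rewrite -[RHS](IHk _ _ sAe (leqW A1)) -?nA ?cA ?addnA ?addn1 ?addSn ?addnS //.
by rewrite -ltnS -cA.
Qed.

End Components.

(** * Binomial weights on the subsets of a finite set *)

Lemma sum_subsets_card (W : nmodType) (T : finType) (E : {set T})
    (g : nat -> W) :
  \sum_(A : {set T} | A \subset E) g #|A|
  = \sum_(k < #|E|.+1) g k *+ 'C(#|E|, k).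
Proof.
rewrite (partition_big (fun A : {set T} => inord #|A| : 'I_#|E|.+1) predT) //=.
apply: eq_bigr => k _; rewrite -cards_draws -sumr_const.
apply: eq_big => [A|A /andP[AE /eqP <-]]; last first.
  by rewrite inordK // ltnS subset_leq_card.
rewrite inE; case: (boolP (A \subset E)) => //= AE.
by rewrite -val_eqE /= inordK // ltnS subset_leq_card.
Qed.

Section Bernstein.

Variables (R : comNzRingType) (x : R).

(** The Bernstein polynomial without its binomial factor: the probability that a given [k]-subset of
    [m] edges is exactly the set kept. The ring is arbitrary so that [x] can be a real number or the
    indeterminate. *)
Definition bernstein m k : R := x ^+ k * (1 - x) ^+ (m - k).

Lemma sum_bernstein m : \sum_(k < m.+1) bernstein m k *+ 'C(m, k) = 1.
Proof.
rewrite -(expr1n R m) -{1}(subrK x 1) exprDn.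
by apply: eq_bigr => k _; rewrite mulrC.
Qed.

Lemma sum_subsets_bernstein (T : finType) (E : {set T}) :
  \sum_(A : {set T} | A \subset E) bernstein #|E| #|A| = 1.
Proof. by rewrite sum_subsets_card sum_bernstein. Qed.

(** The absorption identity for [k * 'C(m, k)] extracts [m] and reduces the mean to the total weight
    for [m - 1]. *)
Lemma mean_bernstein m :
  \sum_(k < m.+1) (bernstein m k *+ k) *+ 'C(m, k) = x *+ m.
Proof.
case: m => [|m]; first by rewrite big_ord1 mulr0n.
rewrite big_ord_recl mulr0n mul0rn add0r -[in RHS](mulr1 x) -(sum_bernstein m).
rewrite -mulrnAr -sumrMnl mulr_sumr; apply: eq_bigr => k _.
rewrite /bernstein lift0 subSS exprS -mulrA -!mulrnAr -!mulrnA.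
by rewrite -mul_bin_diag mulnC.
Qed.

Lemma mean_subsets_bernstein (T : finType) (E : {set T}) :
  \sum_(A : {set T} | A \subset E) bernstein #|E| #|A| *+ #|A| = x *+ #|E|.
Proof.
by rewrite (sum_subsets_card _ (fun k => bernstein #|E| k *+ k)) mean_bernstein.
Qed.

End Bernstein.

(** The exponent [a] cancels, leaving [q ^ (r - c)] with an integer exponent, and [q ^ (- c)] is the
    weight of a [c]-subset divided by [(1 - t) ^ m]. With [a = rank A] and [c = #|A|], the prefactor
    thus does not depend on [A]. *)
Lemma odds_powers (F : fieldType) (t : F) r a c m (q := (1 - t) / t) :
  t != 0 -> 1 - t != 0 -> (a <= r)%N -> (a <= c)%N -> (c <= m)%N ->
  q ^+ (r - a) * q^-1 ^+ (c - a) = q ^+ r / (1 - t) ^+ m * bernstein t m c.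
Proof.
move=> t0 s0 ar ac cm; rewrite /bernstein.
move: (m - c)%N (subnKC cm) (r - a)%N (subnKC ar) (c - a)%N (subnKC ac).
move=> m' <- r' <- c' <-; rewrite !exprD /q exprVn !expr_div_n.
by field; rewrite !expf_neq0.
Qed.

Lemma poly_eq_on_unit_interval (R : realFieldType) (p q : {poly R}) :
  (forall t, 0 < t < 1 -> p.[t] = q.[t]) -> p = q.
Proof.
move=> pq; apply/eqP; rewrite -subr_eq0; apply/negPn/negP => d0.
(* The points [1 / (k + 2)] lie in the open interval, and there are [size d] of them, one more than
   the degree of [d]. *)
set d := p - q in d0; pose rs := [seq (k.+2%:R : R)^-1 | k <- iota 0 (size d)].
have rs_uniq : uniq rs.
  rewrite map_inj_uniq ?iota_uniq // => i j /invr_inj/eqP.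
  by rewrite eqr_nat => /eqP[].
suff /(max_poly_roots d0)/(_ rs_uniq) : all (root d) rs.
  by rewrite size_map size_iota ltnn.
apply/allP => _ /mapP[k _ ->]; rewrite rootE hornerD hornerN pq ?subrr //.
by rewrite invr_gt0 ltr0n invf_lt1 ?ltr0n // ltr1n.
Qed.

(** * From the Tutte polynomial to the coefficients of the integrand *)

Section Integrand.

Variables (R : realType) (V : finType) (E : {set {set V}}).
Hypotheses (simpleE : simple_graph E) (connectedE : connected_graph E).

Implicit Type A : {set {set V}}.

Let sub_simple A : A \subset E -> simple_graph A.
Proof. by move=> /subsetP AE e /AE/simpleE. Qed.

Lemma rank_le_card A : A \subset E -> (rank A <= #|A|)%N.
Proof. by move/sub_simple/card_le_ncomponents; rewrite leq_subLR. Qed.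

Lemma rank_subE A : (rank E - rank A)%N = (ncomponents A).-1.
Proof.
have [V0 _] := connectedE.
rewrite {1}/rank (ncomponents_connected connectedE) /rank.
have := ncomponents_le_card A; have := ncomponents_gt0 A V0.
by case: #|V| (ncomponents A) => [|n] [|k] //= _ kn; rewrite !subSS subn0 subKn.
Qed.

Lemma rank_le_connected A : (rank A <= rank E)%N.
Proof.
rewrite leq_sub2l // ncomponents_connected // ncomponents_gt0 //.
by case: connectedE.
Qed.

Lemma horner_tutte (x y : R) :
  (tutte R E).[x, y] =
  \sum_(A : {set {set V}} | A \subset E)
    (x - 1) ^+ (rank E - rank A) * (y - 1) ^+ (#|A| - rank A).
Proof.
rewrite /tutte !horner_sum; apply: eq_bigr => A _.
by rewrite !hornerE.
Qed.

Lemma horner_deriv_tutte (x y : R) :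
  (tutte R E)^`().[x, y] =
  \sum_(A : {set {set V}} | A \subset E)
    (x - 1) ^+ (rank E - rank A).-1 * (y - 1) ^+ (#|A| - rank A)
      *+ (rank E - rank A).
Proof.
rewrite /tutte raddf_sum !horner_sum; apply: eq_bigr => A _ /=.
(* The [y] factor is a constant in the outer variable, so only the power of ['X - 1] is
   differentiated. *)
have -> : ('Y - 1 : {poly {poly R}}) = ('X - 1)%:P by rewrite polyCB.
rewrite -rmorphXn mulrC derivM derivC mul0r add0r deriv_exp derivB derivX.
by rewrite derivC subr0 mul1r !hornerE !hornerMn mulrC mulrnAl !hornerE.
Qed.

(** By [odds_powers], all summands of the numerator and of the denominator share one nonzero
    prefactor, which cancels; the remaining weights in the denominator sum to 1. *)
Lemma steele_integrandE (t : R) : 0 < t < 1 ->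
  steele_integrand E t =
  \sum_(A : {set {set V}} | A \subset E)
    (rank E - rank A)%:R * bernstein t #|E| #|A|.
Proof.
case/andP=> t0 t1; have s0 : 0 < 1 - t by rewrite subr_gt0.
rewrite /steele_integrand; set q := (1 - t) / t.
have q0 : q != 0 by rewrite mulf_neq0 ?invr_neq0 ?gt_eqF.
have xE : t^-1 - 1 = q by rewrite /q mulrBl divff ?gt_eqF // mul1r.
have yE : (1 - t)^-1 - 1 = q^-1.
  by rewrite /q; field; rewrite !gt_eqF.
have termE A : A \subset E ->
    q ^+ (rank E - rank A) * q^-1 ^+ (#|A| - rank A)
    = q ^+ rank E / (1 - t) ^+ #|E| * bernstein t #|E| #|A|.
  move=> AE; have cAE := subset_leq_card AE.
  by apply: odds_powers; rewrite ?gt_eqF ?rank_le_card ?rank_le_connected.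
have TE : (tutte R E).[t^-1, (1 - t)^-1] = q ^+ rank E / (1 - t) ^+ #|E|.
  rewrite horner_tutte xE yE (eq_bigr _ termE) -mulr_sumr.
  by rewrite sum_subsets_bernstein mulr1.
have DE : q * (tutte R E)^`().[t^-1, (1 - t)^-1] =
    q ^+ rank E / (1 - t) ^+ #|E| *
    \sum_(A : {set {set V}} | A \subset E)
      (rank E - rank A)%:R * bernstein t #|E| #|A|.
  rewrite horner_deriv_tutte xE yE !mulr_sumr; apply: eq_bigr => A AE.
  (* The factor [q] restores the exponent lowered by differentiation; at exponent 0 the truncated
     predecessor is harmless, since the coefficient vanishes. *)
  rewrite mulrCA -termE //; case: (rank E - rank A)%N => [|d].
    by rewrite mulr0n mulr0 mul0r.
  by rewrite mulrnAr mulr_natl mulrA -exprS.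
rewrite mulrA DE TE mulrAC divff ?mul1r // mulf_neq0 ?invr_neq0 //.
  by rewrite expf_neq0.
by rewrite expf_neq0 ?gt_eqF.
Qed.

Lemma polynomial_integrandE (p : {poly R}) : polynomial_integrand E p ->
  p + 1 = \sum_(A : {set {set V}} | A \subset E)
            bernstein 'X #|E| #|A| *+ ncomponents A.
Proof.
case=> _ pE.
have -> : p = \sum_(A : {set {set V}} | A \subset E)
    bernstein 'X #|E| #|A| *+ (rank E - rank A).
  apply: poly_eq_on_unit_interval => t t01; rewrite pE // steele_integrandE //.
  rewrite horner_sum; apply: eq_bigr => A _.
  by rewrite hornerMn mulr_natl /bernstein !hornerE.
(* Writing 1 as the total weight raises each multiplicity from [(ncomponents A).-1] to
   [ncomponents A]. *)
rewrite -[1](sum_subsets_bernstein 'X E) -big_split /=.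
apply: eq_bigr => A _; rewrite -mulrSr rank_subE prednK ?ncomponents_gt0 //.
by case: connectedE.
Qed.

Lemma coef_bernstein_small m k i : (i < k)%N ->
  (bernstein ('X : {poly R}) m k)`_i = 0.
Proof. by move=> ik; rewrite coefXnM ik. Qed.

Lemma integrand_coef_small p i : polynomial_integrand E p -> (i <= 2)%N ->
  integrand_coef p i = (#|V|%:R - 'X *+ #|E| : {poly R})`_i.
Proof.
move=> pE i2; rewrite /integrand_coef (polynomial_integrandE pE).
(* The right-hand side becomes the weighted sum of [#|V| - #|A|], so that both sides can be compared
   one [A] at a time. *)
rewrite -(mean_subsets_bernstein 'X E) -(sum_subsets_bernstein 'X E) -sumrMnl.
rewrite -sumrB !coef_sum; apply: eq_bigr => A AE.
case: (leqP #|A| 2) => [A2|/(leq_ltn_trans i2) iA].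
  by rewrite -(ncomponents_small (sub_simple AE) A2) mulrnDr addrK.
by rewrite coefB !coefMn coef_bernstein_small // !mul0rn subr0.
Qed.

End Integrand.

Theorem theorem3p2 (R : realType) (V : finType) (E : {set {set V}})
    (n m : nat) (p : {poly R}) :
  simple_graph E -> connected_graph E -> #|V| = n -> #|E| = m ->
  polynomial_integrand E p ->
  [/\ integrand_coef p 0 = n%:R,
      integrand_coef p 1 = - m%:R
    & integrand_coef p 2 = 0].
Proof.
move=> simpleE connectedE <- <- pE.
split; rewrite (integrand_coef_small simpleE connectedE pE) //;
  by rewrite coefB coefMn coefX -polyC_natr coefC /= ?mul0rn ?subr0 ?sub0r.
Qed.
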